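(* Let $\mathfrak g=\mathfrak{sl}_{2n+1}$ with $n\ge2$, put $j=n$, $\tau j=n+1$, and let $\mathcal U$ be the algebra defined in the context. Then the central pair $\{j,\tau j\}$ satisfies in $\mathcal U$: $$[\mathbf b_{j,1},[\mathbf b_{j,1},\mathbf b_{\tau j,0}]]+[\mathbf b_{\tau j,1},[\mathbf b_{\tau j,1},\mathbf b_{j,0}]]=0,$$ $$\big[[\mathbf h_{j,1},\mathbf b_{j,1}],\mathbf b_{\tau j,1}\big]-\big[\mathbf b_{j,0},[\mathbf h_{j,1},[\mathbf h_{j,1},\mathbf b_{\tau j,1}]]\big]=0.$$ In fact, the two summands in the first relation vanish separately.
   Context: $[x,y]=xy-yx$. Let $\mathbb I=\{1,\dots,2n\}$, $\tau i=2n+1-i$, and $(c_{ij})_{i,j\in\mathbb I}$ the Cartan matrix of type $\mathsf A_{2n}$. $\mathcal U$ is the unital associative $\mathbb C$-algebra generated by $\mathbf h_{i,r},\mathbf b_{i,r}$ ($i\in\mathbb I$, $r\in\{0,1\}$) subject to, for all $i,j\in\mathbb I$: - $[\mathbf h_{i,r},\mathbf h_{j,s}]=0$ and $\mathbf h_{i,r}=(-1)^{r+1}\mathbf h_{\tau i,r}$ for $0\le r,s\le1$; - $[\mathbf h_{i,0},\mathbf b_{j,r}]=(c_{ij}-c_{\tau i,j})\mathbf b_{j,r}$ for $0\le r\le1$; - $[\mathbf h_{i,1},\mathbf b_{j,0}]=(c_{ij}+c_{\tau i,j})\mathbf b_{j,1}$; - $[\mathbf b_{i,1},\mathbf b_{j,0}]=[\mathbf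 b_{i,0},\mathbf b_{j,1}]-2\delta_{\tau i,j}\mathbf h_{j,1}$; - $[\mathbf b_{i,r},\mathbf b_{\tau i,s}]=(-1)^r\mathbf h_{\tau i,r+s}$ if $r+s\le1$ and $c_{i,\tau i}=0$; - $[\mathbf b_{i,0},\mathbf b_{j,0}]=\delta_{\tau i,j}\mathbf h_{j,0}$ if $c_{ij}=0$; - $[\mathbf b_{i,0},[\mathbf b_{i,0},\mathbf b_{\tau i,0}]]=4\mathbf b_{i,0}$ if $c_{i,\tau i}=-1$; - $[\mathbf b_{i,0},[\mathbf b_{i,0},\mathbf b_{j,0}]]=0$ if $c_{ij}=-1$ and $i\ne\tau i\ne j$. *)

(* Defs.v *)
From HB Require Import structures.
From mathcomp Require Import all_boot all_order all_algebra.
From mathcomp Require Import generic_quotient ring_quotient.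
From mathcomp Require Import boolp reals complex.
From mathcomp Require Import monalg.

Set Implicit Arguments.
Unset Strict Implicit.
Unset Printing Implicit Defensive.

Import GRing.Theory Num.Theory.
Local Open Scope ring_scope.
Local Open Scope quotient_scope.

Definition lie_bracket (A : pzRingType) (x y : A) : A := x * y - y * x.

Notation "[ 'lie' x , y ]" := (lie_bracket x y)
  (at level 0, x, y at level 99, format "[ 'lie'  x ,  y ]") : ring_scope.

(* The monoid algebra of the free monoid on G; monalg only declares it as a
   left algebra. *)
Definition free_alg (K : comNzRingType) (G : choiceType) : Type :=
  {malg K[{fmonom G}]}.

Section FreeAlg.
Variables (K : comNzRingType) (G : choiceType).

HB.instance Definition _ := GRing.Lalgebra.copy (free_alg K G)
  {malg K[{fmonom G}]}.

Fact free_alg_scalerAr (k : K) (x y : free_alg K G) :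
  k *: (x * y) = x * (k *: y).
Proof.
have malgZE (g : {malg K[{fmonom G}]}) : k *: g = malgC k * g.
  rewrite malgM_def fgmulUg; apply/malgP => m.
  rewrite mcoeffZ raddf_sum /= {1}[g]monalgE raddf_sum /= big_distrr /=.
  by apply: eq_bigr => l _; rewrite mul1m !mcoeffU mulrnAr.
have comm (g : {malg K[{fmonom G}]}) : malgC k * g = g * malgC k.
  rewrite !malgM_def fgmulUg fgmulgU.
  by apply: eq_bigr => l _; rewrite mul1m mulm1 mulrC.
change (k *: (x * y : {malg K[{fmonom G}]}) =
  (x : {malg K[{fmonom G}]}) * (k *: (y : {malg K[{fmonom G}]}))).
by rewrite !malgZE !mulrA comm.
Qed.

HB.instance Definition _ :=
  GRing.Lalgebra_isAlgebra.Build K (free_alg K G) free_alg_scalerAr.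

Definition free_gen (g : G) : free_alg K G := << fmu g >>.

End FreeAlg.

(* A relation [rel x y] stands for the equation x = y.  Closure under scalars
   is automatic since k *: x = (k *: 1) * x. *)
Inductive rel_ideal (A : pzRingType) (rel : A -> A -> Prop) : A -> Prop :=
| RelIdealBase x y of rel x y : rel_ideal rel (x - y)
| RelIdeal0 : rel_ideal rel 0
| RelIdealB x y of rel_ideal rel x & rel_ideal rel y : rel_ideal rel (x - y)
| RelIdealMl a x of rel_ideal rel x : rel_ideal rel (a * x)
| RelIdealMr x a of rel_ideal rel x : rel_ideal rel (x * a).

Section RelQuotient.
Variables (K : comNzRingType) (A : algType K) (rel : A -> A -> Prop).

Definition rel_idealb : pred A := fun x => `[< rel_ideal rel x >].

Fact rel_idealb_zmod_closed : zmod_closed rel_idealb.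
Proof.
split; first exact/asboolP/RelIdeal0.
by move=> x y /asboolP hx /asboolP hy; apply/asboolP/RelIdealB.
Qed.

HB.instance Definition _ :=
  GRing.isZmodClosed.Build A rel_idealb rel_idealb_zmod_closed.

Definition rel_zmodClosed : zmodClosed A :=
  GRing.ZmodClosed.clone A rel_idealb _.

(* Algebras of MathComp are non-trivial rings, so properness of the ideal is
   part of the data. *)
Hypothesis proper : ~ rel_ideal rel 1.

Definition rel_quot of ~ rel_ideal rel 1 : Type := @Quotient.quot A rel_zmodClosed.
Local Notation Q := (rel_quot proper).

HB.instance Definition _ := GRing.Zmodule.copy Q (@Quotient.quot A rel_zmodClosed).
HB.instance Definition _ := EqQuotient.copy Q (@Quotient.quot A rel_zmodClosed).

Definition rel_pi (x : A) : Q := \pi_Q x.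

Lemma rel_piP x y : rel_pi x = rel_pi y <-> rel_ideal rel (x - y).
Proof.
have -> : (rel_pi x = rel_pi y) <-> (x - y \in rel_zmodClosed).
  by rewrite Quotient.idealrBE; split => [/eqP|/eqP].
by split => /asboolP.
Qed.

Lemma rel_piD x y : rel_pi (x + y) = rel_pi x + rel_pi y.
Proof. exact: (@Quotient.pi_add A rel_zmodClosed). Qed.

Lemma rel_pi_ind (P : Q -> Prop) : (forall x, P (rel_pi x)) -> forall q, P q.
Proof. by move=> h q; rewrite -[q]reprK; apply: h. Qed.

Definition rel_mul (p q : Q) : Q := rel_pi (repr p * repr q).
Definition rel_scale (k : K) (q : Q) : Q := rel_pi (k *: repr q).

Lemma rel_repr x : rel_ideal rel (repr (rel_pi x) - x).
Proof. by apply/rel_piP; exact: reprK. Qed.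

Lemma rel_piM x y : rel_pi (x * y) = rel_mul (rel_pi x) (rel_pi y).
Proof.
apply/esym/rel_piP; rewrite -[_ * _](subrK (x * repr (rel_pi y))).
rewrite -mulrBl -addrA -mulrBr -[_ * (_ - _)]opprK -mulrN opprB.
apply: RelIdealB; first exact/RelIdealMr/rel_repr.
by apply/RelIdealMl; rewrite -opprB -sub0r; apply/RelIdealB/rel_repr/RelIdeal0.
Qed.

Lemma rel_piZ k x : rel_pi (k *: x) = rel_scale k (rel_pi x).
Proof.
apply/esym/rel_piP; rewrite -scalerBr -[_ - _]mul1r scalerAl.
exact/RelIdealMl/rel_repr.
Qed.

Fact rel_mulA : associative rel_mul.
Proof.
by elim/rel_pi_ind=> x; elim/rel_pi_ind=> y; elim/rel_pi_ind=> z;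
  rewrite -!rel_piM mulrA.
Qed.

Fact rel_mul1q : left_id (rel_pi 1) rel_mul.
Proof. by elim/rel_pi_ind=> x; rewrite -rel_piM mul1r. Qed.

Fact rel_mulq1 : right_id (rel_pi 1) rel_mul.
Proof. by elim/rel_pi_ind=> x; rewrite -rel_piM mulr1. Qed.

Fact rel_mulDl : left_distributive rel_mul +%R.
Proof.
by elim/rel_pi_ind=> x; elim/rel_pi_ind=> y; elim/rel_pi_ind=> z;
  rewrite -!(rel_piD, rel_piM) mulrDl.
Qed.

Fact rel_mulDr : right_distributive rel_mul +%R.
Proof.
by elim/rel_pi_ind=> x; elim/rel_pi_ind=> y; elim/rel_pi_ind=> z;
  rewrite -!(rel_piD, rel_piM) mulrDr.
Qed.

Fact rel_pi0 : rel_pi 0 = 0.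
Proof. by apply: (addrI (rel_pi 0)); rewrite -rel_piD !addr0. Qed.

Fact rel_1neq0 : rel_pi 1 != 0.
Proof. by apply/eqP; rewrite -rel_pi0 => /rel_piP; rewrite subr0. Qed.

HB.instance Definition _ := GRing.Zmodule_isNzRing.Build Q
  rel_mulA rel_mul1q rel_mulq1 rel_mulDl rel_mulDr rel_1neq0.

Fact rel_scaleA a b q : rel_scale a (rel_scale b q) = rel_scale (a * b) q.
Proof. by elim/rel_pi_ind: q => x; rewrite -!rel_piZ scalerA. Qed.

Fact rel_scale1q : left_id 1 rel_scale.
Proof. by elim/rel_pi_ind=> x; rewrite -rel_piZ scale1r. Qed.

Fact rel_scaleDr : right_distributive rel_scale +%R.
Proof.
move=> k; elim/rel_pi_ind=> x; elim/rel_pi_ind=> y.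
by rewrite -!(rel_piD, rel_piZ) scalerDr.
Qed.

Fact rel_scaleDl q : {morph rel_scale^~ q : a b / a + b}.
Proof.
move=> a b; elim/rel_pi_ind: q => x /=.
by rewrite -!(rel_piD, rel_piZ) scalerDl.
Qed.

HB.instance Definition _ := GRing.Zmodule_isLmodule.Build K Q
  rel_scaleA rel_scale1q rel_scaleDr rel_scaleDl.

Fact rel_scalerAl k (p q : Q) : k *: (p * q) = (k *: p) * q.
Proof.
elim/rel_pi_ind: p => x; elim/rel_pi_ind: q => y.
by rewrite /GRing.scale /GRing.mul /= -!(rel_piM, rel_piZ) scalerAl.
Qed.

HB.instance Definition _ := GRing.Lmodule_isLalgebra.Build K Q rel_scalerAl.

Fact rel_scalerAr k (p q : Q) : k *: (p * q) = p * (k *: q).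
Proof.
elim/rel_pi_ind: p => x; elim/rel_pi_ind: q => y.
by rewrite /GRing.scale /GRing.mul /= -!(rel_piM, rel_piZ) scalerAr.
Qed.

HB.instance Definition _ := GRing.Lalgebra_isAlgebra.Build K Q rel_scalerAr.

Fact rel_pi_zmod_morphism : zmod_morphism rel_pi.
Proof.
move=> x y; apply: (addIr (rel_pi y)).
by rewrite -rel_piD !subrK.
Qed.
HB.instance Definition _ :=
  GRing.isZmodMorphism.Build A Q rel_pi rel_pi_zmod_morphism.

Fact rel_pi_monoid_morphism : monoid_morphism rel_pi.
Proof. by split=> // x y; exact: rel_piM. Qed.
HB.instance Definition _ :=
  GRing.isMonoidMorphism.Build A Q rel_pi rel_pi_monoid_morphism.

Fact rel_pi_scalable : scalable rel_pi.
Proof. by move=> k x; exact: rel_piZ. Qed.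
HB.instance Definition _ :=
  GRing.isScalable.Build K A Q *:%R rel_pi rel_pi_scalable.

End RelQuotient.

Definition cartanA (m : nat) (i j : 'I_m) : int :=
  if i == j then 2%:Z
  else if (i.+1 == j :> nat) || (j.+1 == i :> nat) then - 1%:Z else 0.

(* Indices are shifted by one: k : 'I_(2 * n) stands for the index k + 1 of
   {1, ..., 2n}.  Then k |-> 2n + 1 - k becomes k |-> 2n - 1 - k. *)
Definition tau (n : nat) : 'I_(2 * n) -> 'I_(2 * n) := @rev_ord (2 * n).

(* inl (i, r) is the generator h_{i,r} and inr (i, r) the generator b_{i,r}. *)
Definition U_gen (n : nat) : choiceType :=
  (('I_(2 * n) * 'I_2) + ('I_(2 * n) * 'I_2))%type.

(* The base field is R[i], the complex numbers over R : realType. *)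
Section Algebra.
Variables (R : realType) (n : nat).

Local Notation F := (free_alg R[i] (U_gen n)).
Local Notation c := (@cartanA (2 * n)).
Local Notation tau := (@tau n).

Definition free_h (i : 'I_(2 * n)) (r : 'I_2) : F :=
  free_gen R[i] (inl (i, r) : U_gen n).
Definition free_b (i : 'I_(2 * n)) (r : 'I_2) : F :=
  free_gen R[i] (inr (i, r) : U_gen n).

Local Notation h := free_h.
Local Notation b := free_b.

Inductive U_rel : F -> F -> Prop :=
| U_hh i j r s :
    U_rel [lie h i r, h j s] 0
| U_htau i (r : 'I_2) :
    U_rel (h i r) ((-1) ^+ r.+1 *: h (tau i) r)
| U_h0b i j r :
    U_rel [lie h i 0, b j r] ((c i j - c (tau i) j)%:~R *: b j r)
| U_h1b i j :
    U_rel [lie h i 1, b j 0] ((c i j + c (tau i) j)%:~R *: b j 1)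
| U_b1b i j :
    U_rel [lie b i 1, b j 0]
      ([lie b i 0, b j 1] - (2 * (tau i == j))%:R *: h j 1)
| U_bbtau i (r s t : 'I_2) of t = (r + s)%N :> nat & c i (tau i) = 0 :
    U_rel [lie b i r, b (tau i) s] ((-1) ^+ r *: h (tau i) t)
| U_bb i j of c i j = 0 :
    U_rel [lie b i 0, b j 0] ((tau i == j)%:R *: h j 0)
| U_serre_tau i of c i (tau i) = -1 :
    U_rel [lie b i 0, [lie b i 0, b (tau i) 0]] (4%:R *: b i 0)
| U_serre i j of c i j = -1 & i != tau i & tau i != j :
    U_rel [lie b i 0, [lie b i 0, b j 0]] 0.

(* All the relations have constant coefficient 0, so U is not trivial. *)
Lemma U_rel_proper : ~ rel_ideal U_rel 1.
Proof.
pose e : {malg R[i][{fmonom U_gen n}]} -> R[i] :=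
  mcoeff (@mone {fmonom U_gen n}).
have e1 : e 1 = 1 by exact: rmorph1.
have e0 : e 0 = 0 by exact: raddf0.
have eB x y : e (x - y) = e x - e y by exact: raddfB.
have eM x y : e (x * y) = e x * e y by exact: rmorphM.
have eZ k x : e (k *: x) = k * e x by exact: mcoeffZ.
have eg g : e << fmu g >> = 0.
  rewrite /e mcoeffU1; case: eqP => // /(congr1 (@fmonom_val _)).
  by rewrite fm1 fmuE.
have eh i r : e (h i r) = 0 by exact: eg.
have eb i r : e (b i r) = 0 by exact: eg.
have eL (x y : F) : e [lie x, y] = 0 by rewrite eB !eM mulrC subrr.
have eI x : rel_ideal U_rel x -> e x = 0.
  elim=> [y z yz||y z _ Hy _ Hz|a y _ IH|y a _ IH].
  - by rewrite eB; case: yz => *; rewrite ?(eL, eB, eZ, eh, eb, e0);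
      rewrite ?mulr0 ?subr0.
  - exact: e0.
  - by rewrite eB Hy Hz subr0.
  - by rewrite eM IH mulr0.
  - by rewrite eM IH mul0r.
by move/eI/eqP; rewrite e1 oner_eq0.
Qed.

Definition U : algType R[i] := rel_quot U_rel_proper.

Definition Uh (i : 'I_(2 * n)) (r : 'I_2) : U := rel_pi U_rel_proper (h i r).
Definition Ub (i : 'I_(2 * n)) (r : 'I_2) : U := rel_pi U_rel_proper (b i r).

End Algebra.

Arguments Uh R {n} i r.
Arguments Ub R {n} i r.

(* Main.v *)
(* Write x, y for b_{j,0}, b_{tau j,0} and u, v for b_{j-1,0}, b_{tau(j-1),0}.
   The commuting elements d = 2 h_{j,1} + h_{j-1,1} and e = h_{j,1} + h_{j-1,1}
   raise the degree on {x, y} and on {u, v} respectively and kill the other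
   pair; put x_k = (ad d)^k x, u_k = (ad e)^k u, and so on.

   The first relation: the degree two Cartan-like element
   q = [u_2, v] = [u, v_2] acts by [q, x] = x_2 and [q, y] = - y_2.  Applying
   ad q and (ad d)^2 to the Serre relation [x, [x, y]] = 4 x gives
   [x_1, [x_1, y]] = 0.

   The second relation: h = d - e = h_{j,1} kills w_1 = [u, x_1] and
   z_1 = [v, y_1].  Applying ad h to
     [[y, w_1], [x, z_1]] = 2 [x_2, y] + 2 [w_1, z_1]
   gives [x_3, y] = [x_1, y_2], which is equivalent to the claim by applying
   ad d to [x_2, y] = [x, y_2]. *)
Require Import Defs.
From mathcomp Require Import all_boot all_order all_algebra.
From mathcomp Require Import reals complex zify.

Set Implicit Arguments.
Unset Strict Implicit.
Unset Printing Implicit Defensive.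

Import GRing.Theory Num.Theory.
Local Open Scope ring_scope.

(** * Commutators form a Lie bracket *)

Section LieBracket.
Variable A : pzRingType.
Implicit Types a b c : A.

Lemma lieC a b : [lie a, b] = - [lie b, a].
Proof. by rewrite /lie_bracket opprB. Qed.

Lemma lieDr a b c : [lie a, b + c] = [lie a, b] + [lie a, c].
Proof. by rewrite /lie_bracket mulrDl mulrDr opprD addrACA. Qed.

Lemma lie_jacobi a b c :
  [lie a, [lie b, c]] = [lie [lie a, b], c] + [lie b, [lie a, c]].
Proof.
rewrite /lie_bracket !mulrBl !mulrBr !mulrA !opprB.
rewrite [RHS]addrACA !subrKA [LHS]addrACA [RHS]addrACA.
by congr (_ + _); rewrite addrC.
Qed.
End LieBracket.

Lemma rmorph_lie (A B : pzRingType) (f : {rmorphism A -> B}) x y :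
  f [lie x, y] = [lie f x, f y].
Proof. by rewrite /lie_bracket rmorphB !rmorphM. Qed.

(* The bracket is abstract here so that unification cannot unfold it. *)
Section LieAlgebra.
Variables (K : numFieldType) (A : lmodType K) (br : A -> A -> A).
Local Notation "[ 'br' a , b ]" := (br a b)
  (at level 0, a, b at level 99, format "[ 'br'  a ,  b ]").

Hypothesis brC : forall a b, [br a, b] = - [br b, a].
Hypothesis brDr : forall a b c, [br a, b + c] = [br a, b] + [br a, c].
Hypothesis br_jacobi : forall a b c,
  [br a, [br b, c]] = [br [br a, b], c] + [br b, [br a, c]].

Implicit Types a b c : A.

(** * Bracket calculus, with cancellation of integers in characteristic zero *)

Lemma mulrn_injl n a b : (0 < n)%N -> a *+ n = b *+ n -> a = b.
Proof.
move=> n_gt0; rewrite -!scaler_nat => /scalerI; apply.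
by rewrite pnatr_eq0 -lt0n.
Qed.

Lemma eq_opp0 a : a = - a -> a = 0.
Proof.
move=> aN; apply: (@mulrn_injl 2) => //.
by rewrite mulr2n {2}aN subrr mul0rn.
Qed.

Lemma brxx a : [br a, a] = 0.
Proof. exact/eq_opp0/brC. Qed.

Lemma br0r a : [br a, 0] = 0.
Proof. by apply: (addIr [br a, 0]); rewrite -brDr !add0r. Qed.

Lemma brNr a b : [br a, - b] = - [br a, b].
Proof. by apply: (addIr [br a, b]); rewrite -brDr !addNr br0r. Qed.

Lemma brMnr a b n : [br a, b *+ n] = [br a, b] *+ n.
Proof.
by elim: n => [|n IH]; rewrite ?br0r // !mulrS brDr IH.
Qed.

Lemma brDl a b c : [br a + b, c] = [br a, c] + [br b, c].
Proof. by rewrite brC brDr opprD -!brC. Qed.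

Lemma br0l a : [br 0, a] = 0.
Proof. by rewrite brC br0r oppr0. Qed.

Lemma brNl a b : [br - a, b] = - [br a, b].
Proof. by rewrite brC brNr -brC. Qed.

Lemma brMnl a b n : [br a *+ n, b] = [br a, b] *+ n.
Proof. by rewrite brC brMnr -mulNrn -brC. Qed.

Lemma br_brl a b c :
  [br [br a, b], c] = [br a, [br b, c]] - [br b, [br a, c]].
Proof. by rewrite br_jacobi addrK. Qed.

Lemma br_jacobil a b c :
  [br [br a, b], c] = [br [br a, c], b] + [br a, [br b, c]].
Proof. by rewrite br_jacobi addrCA (brC b [br _, _]) subrr addr0. Qed.

(* In the application [u, v] = - h_{j-1,0}, so cp_uvx and cp_uvy are weights. *)
Record central_pair (d e h x y u v : A) : Prop := CentralPair {
  cp_h : h = d - e;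
  cp_de : [br d, e] = 0;
  cp_ex : [br e, x] = 0;
  cp_ey : [br e, y] = 0;
  cp_du : [br d, u] = 0;
  cp_dv : [br d, v] = 0;
  cp_xx : [br x, [br d, x]] = 0;
  cp_yy : [br y, [br d, y]] = 0;
  cp_xy : [br x, [br d, y]] = [br [br d, x], y] + h *+ 2;
  cp_ux : [br [br e, u], x] = [br u, [br d, x]];
  cp_vy : [br [br e, v], y] = [br v, [br d, y]];
  cp_xv : [br x, v] = 0;
  cp_yu : [br y, u] = 0;
  cp_xxy : [br x, [br x, y]] = x *+ 4;
  cp_yyx : [br y, [br y, x]] = y *+ 4;
  cp_xxu : [br x, [br x, u]] = 0;
  cp_yyv : [br y, [br y, v]] = 0;
  cp_uvx : [br [br u, v], x] = x;
  cp_uvy : [br [br u, v], y] = - y;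
  cp_duv : [br d, [br u, v]] = 0;
  cp_euv : [br e, [br u, v]] = 0;
  cp_euv1 : [br e, [br u, [br e, v]]] = 0
}.

(** The symmetry under tau: each later identity also holds with x, y and u, v swapped. The one field
    needing work uses that e kills [u, v]. *)
Lemma central_pairC d e h x y u v :
  central_pair d e h x y u v -> central_pair d e h y x v u.
Proof.
case=> hE de ex ey du dv xx yy xy ux vy xv yu.
move=> xxy yyx xxu yyv uvx uvy duv euv euv1.
have uv1 : [br u, [br e, v]] = [br v, [br e, u]].
  by apply/eqP; rewrite (brC v) -addr_eq0 addrC -br_jacobi euv.
split=> //.
- by rewrite (brC [br d, y]) xy opprD addrNK -brC.
- by rewrite (brC v u) brNl uvy opprK.
- by rewrite (brC v u) brNl uvx.
- by rewrite (brC v u) brNr duv oppr0.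
- by rewrite (brC v u) brNr euv oppr0.
- by rewrite -uv1.
Qed.

(** * Degree shifts by d and e, and the element q *)

Section Actions.
Variables d e h x y u v : A.
Hypothesis cp : central_pair d e h x y u v.

Let x1 := [br d, x].
Let x2 := [br d, x1].
Let y1 := [br d, y].
Let y2 := [br d, y1].
Let u1 := [br e, u].
Let w1 := [br u, x1].

Lemma cp_ad_de a : [br d, [br e, a]] = [br e, [br d, a]].
Proof. by rewrite br_jacobi (cp_de cp) br0l add0r. Qed.

Lemma cp_shift a b : [br d, b] = 0 -> [br a, b] = 0 -> [br [br d, a], b] = 0.
Proof.
move=> db ab; have := br_jacobi d a b.
by rewrite ab db !br0r addr0.
Qed.

Lemma cp_ex1 : [br e, x1] = 0.
Proof. by rewrite -cp_ad_de (cp_ex cp) br0r. Qed.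

Lemma cp_ex2 : [br e, x2] = 0.
Proof. by rewrite -cp_ad_de cp_ex1 br0r. Qed.

Lemma cp_hx : [br h, x] = x1.
Proof. by rewrite (cp_h cp) brDl brNl (cp_ex cp) subr0. Qed.

Lemma cp_hx1 : [br h, x1] = x2.
Proof. by rewrite (cp_h cp) brDl brNl cp_ex1 subr0. Qed.

Lemma cp_xy1 : [br x, y1] = [br x1, y] + h *+ 2.
Proof. exact: (cp_xy cp). Qed.

Lemma cp_x1v : [br x1, v] = 0.
Proof. exact: cp_shift (cp_dv cp) (cp_xv cp). Qed.

Lemma cp_x2v : [br x2, v] = 0.
Proof. exact: cp_shift (cp_dv cp) cp_x1v. Qed.

Lemma cp_y1u : [br y1, u] = 0.
Proof. exact: cp_shift (cp_du cp) (cp_yu cp). Qed.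

Lemma cp_yu1 : [br y, u1] = 0.
Proof.
have := br_jacobi e y u.
by rewrite (cp_yu cp) (cp_ey cp) br0l br0r add0r.
Qed.

Lemma cp_y1u1 : [br y1, u1] = 0.
Proof. by apply: cp_shift cp_yu1; rewrite cp_ad_de (cp_du cp) br0r. Qed.

Lemma cp_x2x : [br x2, x] = 0.
Proof.
rewrite brC; have := br_jacobi d x x1.
by rewrite (cp_xx cp) brxx br0r add0r => <-; rewrite oppr0.
Qed.

Lemma cp_du1 : [br d, u1] = 0.
Proof. by rewrite cp_ad_de (cp_du cp) br0r. Qed.

(* [u_i, x_k] depends only on i + k. *)
Lemma cp_u1x1 : [br u1, x1] = [br u, x2].
Proof.
have := congr1 (br d) (cp_ux cp).
rewrite (br_jacobi d (br e u)) (br_jacobi d u).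
by rewrite cp_du1 (cp_du cp) !br0l !add0r.
Qed.

Lemma cp_u2x : [br [br e, u1], x] = [br u, x2].
Proof.
have := congr1 (br e) (cp_ux cp).
rewrite (br_jacobi e (br e u)) (br_jacobi e u).
by rewrite (cp_ex cp) cp_ex1 !br0r !addr0 -cp_u1x1.
Qed.

(** Both ad d and ad e send w_1 to [u, x_2], and h = d - e. *)
Lemma cp_hw1 : [br h, w1] = 0.
Proof.
rewrite (cp_h cp) brDl brNl (br_jacobi d u) (br_jacobi e u).
by rewrite (cp_du cp) cp_ex1 br0l br0r add0r addr0 cp_u1x1 subrr.
Qed.

Lemma cp_x1xy : [br x1, [br x, y]] = [br x, [br x1, y]].
Proof. by rewrite br_jacobi (brC x1 x) (cp_xx cp) oppr0 br0l add0r. Qed.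

(** Applying ad d to [x, [x, y]] = 4 x gives three copies of the left side, plus 2 [x, h] = -2 x_1
    from [cp_xy1]. *)
Lemma cp_xx1y : [br x, [br x1, y]] = x1 *+ 2.
Proof.
have := congr1 (br d) (cp_xxy cp).
rewrite br_jacobi cp_x1xy (br_jacobi d x y) -/x1 -/y1 cp_xy1.
rewrite 2!brDr !brMnr (brC x h) cp_hx 2!addrA -mulr2n -mulrSr => E.
apply: (@mulrn_injl 3) => //; apply: (addIr (- x1 *+ 2)).
by rewrite E mulNrn -mulrnA -mulrnBr.
Qed.

Lemma cp_xxy1 : [br x, [br x, y1]] = 0.
Proof. by rewrite cp_xy1 brDr cp_xx1y brMnr (brC x h) cp_hx mulNrn subrr. Qed.

Lemma cp_dh : [br d, h] = 0.
Proof. by rewrite (cp_h cp) brDr brNr brxx (cp_de cp) subr0. Qed.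

(** Apply ad d to [cp_xy1]: it kills h, and [x_1, y_1] cancels. *)
Lemma cp_xy2 : [br x, y2] = [br x2, y].
Proof.
have := congr1 (br d) cp_xy1.
rewrite brDr brMnr cp_dh mul0rn addr0 (br_jacobi d x) (br_jacobi d x1).
by rewrite -/x1 -/x2 -/y1 -/y2 addrC => /addIr.
Qed.

(** Since e kills [u, v] and [u, v_1], both sides equal -[u_1, v_1]. The two forms of q suit x and y
    respectively. *)
Lemma cp_uv2 : [br [br e, u1], v] = [br u, [br e, [br e, v]]].
Proof.
have E1 : [br u1, [br e, v]] = - [br u, [br e, [br e, v]]].
  by apply/eqP; rewrite -addr_eq0 -br_jacobi (cp_euv1 cp).
have E2 : [br u1, v] = - [br u, [br e, v]].
  by apply/eqP; rewrite -addr_eq0 -br_jacobi (cp_euv cp).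
have := congr1 (br e) E2.
rewrite brNr (cp_euv1 cp) oppr0 br_jacobi E1 => /eqP.
by rewrite subr_eq0 => /eqP.
Qed.

Lemma cp_weight p a : [br d, p] = 0 -> [br p, a] = a ->
  [br p, [br d, a]] = [br d, a].
Proof. by move=> dp /(congr1 (br d)); rewrite br_jacobi dp br0l add0r. Qed.

Lemma cp_uvx2 : [br [br u, v], x2] = x2.
Proof. by do 2!apply: cp_weight (cp_duv cp) _; exact: (cp_uvx cp). Qed.

Lemma cp_uvx1 : [br [br u, v], x1] = x1.
Proof. by apply: cp_weight (cp_duv cp) _; exact: (cp_uvx cp). Qed.

Lemma cp_y2u : [br y2, u] = 0.
Proof. exact: cp_shift (cp_du cp) cp_y1u. Qed.

(** In the form q = [u_2, v], v commutes with x and x_2, and [u_2, x] = [u, x_2]; what remains is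
    the weight of [u, v] on x_2. *)
Lemma cp_qx : [br [br u, [br e, [br e, v]]], x] = x2.
Proof.
rewrite -cp_uv2 br_jacobil cp_u2x (brC v) (cp_xv cp) oppr0 br0r addr0.
by rewrite br_jacobil cp_x2v br0r addr0 cp_uvx2.
Qed.
End Actions.

(** * The first relation, and brackets with w_1 and z_1 *)

Section FirstRelation.
Variables d e h x y u v : A.
Hypothesis cp : central_pair d e h x y u v.

Let cpC := central_pairC cp.
Let x1 := [br d, x].
Let x2 := [br d, x1].
Let y1 := [br d, y].
Let y2 := [br d, y1].
Let u1 := [br e, u].
Let w1 := [br u, x1].
Let z1 := [br v, y1].

Lemma cp_qy : [br [br u, [br e, [br e, v]]], y] = - y2.
Proof.
rewrite br_jacobil (cp_u2x cpC) (brC u) (cp_yu cp) oppr0 br0l add0r.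
rewrite br_jacobi (brC u (br d _)) (cp_y2u cp) oppr0 br0r addr0.
by rewrite (brC u) brNl (cp_uvx2 cpC).
Qed.

(** Apply ad q to [x, [x, y]] = 4 x: inside the bracket with x, [x_2, y] - [x, y_2] cancels, and x_2
    commutes with x. *)
Lemma cp_xx2y : [br x, [br x2, y]] = x2 *+ 4.
Proof.
set q := [br u, [br e, [br e, v]]].
have qx : [br q, x] = x2 by exact: (cp_qx cp).
have := congr1 (br q) (cp_xxy cp).
rewrite brMnr qx (br_jacobi q x) qx (br_jacobi q x y) qx cp_qy brNr.
rewrite (cp_xy2 cp) subrr br0r addr0.
by rewrite (br_jacobi x2 x) (cp_x2x cp) br0l add0r.
Qed.

Lemma cp_xx1y1E : [br x, [br x1, y1]] = [br x1, [br x1, y]] - x2 *+ 2.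
Proof.
rewrite (br_jacobi x x1) (cp_xx cp) br0l add0r (cp_xy1 cp) brDr brMnr.
by rewrite (brC x1 h) (cp_hx1 cp) mulNrn.
Qed.

(** Apply ad d to [cp_xx1y]: the left side becomes 2 [x_1, [x_1, y]] + 4 x_2 - 2 x_2, the right side
    2 x_2. *)
Lemma cp_x1x1y : [br x1, [br x1, y]] = 0.
Proof.
have := congr1 (br d) (cp_xx1y cp).
rewrite brMnr (br_jacobi d x) (br_jacobi d x1 y) brDr cp_xx2y cp_xx1y1E.
rewrite addrCA [X in _ + X]addrA -mulr2n addrCA -mulrnBr // => E.
apply: (@mulrn_injl 2) => //; rewrite mul0rn.
by apply: (addIr (x2 *+ 2)); rewrite add0r.
Qed.

Lemma cp_xx1y1 : [br x, [br x1, y1]] = - (x2 *+ 2).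
Proof. by rewrite cp_xx1y1E cp_x1x1y sub0r. Qed.

Lemma cp_w1E : w1 = [br u1, x].
Proof. by rewrite (cp_ux cp). Qed.

Lemma cp_xu1 : [br x, u1] = - w1.
Proof. by rewrite brC -cp_w1E. Qed.

Lemma cp_e_xu : [br e, [br x, u]] = - w1.
Proof. by rewrite br_jacobi (cp_ex cp) br0l add0r cp_xu1. Qed.

Lemma cp_xw1 : [br x, w1] = 0.
Proof.
have := congr1 (br e) (cp_xxu cp).
rewrite (br_jacobi e x) (cp_ex cp) br0l add0r cp_e_xu br0r brNr.
by move/eqP; rewrite oppr_eq0 => /eqP.
Qed.

(** Apply ad d, then ad e, to the Serre relation [x, [x, u]] = 0. *)
Lemma cp_x1w1 : [br x1, w1] = 0.
Proof.
have x1xu : [br x1, [br x, u]] = 0.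
  have := congr1 (br d) (cp_xxu cp).
  rewrite (br_jacobi d x) (br_jacobi d x u) (cp_du cp) !br0r addr0.
  by rewrite (brC x1 u) brNr cp_xw1 oppr0 addr0.
have := congr1 (br e) x1xu.
rewrite (br_jacobi e x1) (cp_ex1 cp) br0l add0r cp_e_xu br0r brNr.
by move/eqP; rewrite oppr_eq0 => /eqP.
Qed.

(** It equals [w_1, [x, y_1]] because x commutes with w_1, and minus that on expanding w_1 =
    [u_1, x]. *)
Lemma cp_xw1y1 : [br x, [br w1, y1]] = 0.
Proof.
apply: eq_opp0.
rewrite [X in _ = - X]br_jacobi cp_xw1 br0l add0r.
rewrite [in LHS]cp_w1E br_jacobil (brC _ y1) (cp_y1u1 cp) oppr0 br0l add0r.
by rewrite (br_jacobi x u1) cp_xu1 (cp_xxy1 cp) br0r addr0 brNl.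
Qed.

(** Expanding w_1 = [u, x_1] in [w_1, [x_1, y]] and using the first relation shows that [x_1,
    [w_1, y]] is its own negative. *)
Lemma cp_x1yw1 : [br x1, [br y, w1]] = 0.
Proof.
have E : [br x1, [br w1, y]] = [br w1, [br x1, y]].
  by rewrite br_jacobi cp_x1w1 br0l add0r.
rewrite (brC y) brNr E; apply/eqP; rewrite oppr_eq0; apply/eqP/eq_opp0.
rewrite -{2}E br_brl cp_x1x1y br0r sub0r; congr (- [br x1, _]).
by rewrite br_jacobi (brC u y) (cp_yu cp) oppr0 br0r addr0.
Qed.

(** Two evaluations are added: [[x, y], w_1], and, from w_1 = [u_1, x], [w_1, [x, y]] - 4 w_1. *)
Lemma cp_xyw1 : [br x, [br y, w1]] = - (w1 *+ 2).
Proof.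
have E : [br x, [br y, w1]] = [br [br x, y], w1].
  by rewrite br_jacobi cp_xw1 br0r addr0.
apply: (@mulrn_injl 2) => //; rewrite mulr2n {1}E.
rewrite [in X in _ + X]cp_w1E (br_jacobi y u1) (cp_yu1 cp) br0l add0r.
rewrite (br_jacobi x u1) cp_xu1 (brC y) brNl !brNr opprK (cp_xxy cp).
by rewrite (brC w1) addrA subrr add0r brMnr -cp_w1E mulNrn -mulrnA.
Qed.

(** Move x outside, as it commutes with w_1; then [w_1, z_1] = [x_1, y_1] + [v, [w_1, y_1]], and ad
    x kills the last term. *)
Lemma cp_w1xz1 : [br w1, [br x, z1]] = - (x2 *+ 2).
Proof.
have w1v : [br w1, v] = x1.
  by rewrite br_jacobil (cp_x1v cp) br0r addr0 (cp_uvx1 cp).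
rewrite br_jacobi (brC w1 x) cp_xw1 oppr0 br0l add0r.
rewrite (br_jacobi w1 v) w1v brDr cp_xx1y1.
by rewrite (br_jacobi x v) (cp_xv cp) br0l add0r cp_xw1y1 br0r addr0.
Qed.
End FirstRelation.

(** * The second relation *)

Section SecondRelation.
Variables d e h x y u v : A.
Hypothesis cp : central_pair d e h x y u v.

Let cpC := central_pairC cp.
Let x1 := [br d, x].
Let x2 := [br d, x1].
Let x3 := [br d, x2].
Let y1 := [br d, y].
Let y2 := [br d, y1].
Let y3 := [br d, y2].
Let w1 := [br u, x1].
Let z1 := [br v, y1].

Lemma cp_yw1xz1 :
  [br [br y, w1], [br x, z1]] = ([br x2, y] + [br w1, z1]) *+ 2.
Proof.
rewrite br_brl (cp_w1xz1 cp) (cp_xyw1 cpC) !brNr opprK !brMnr.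
by rewrite (brC y) mulNrn opprK mulrnDl.
Qed.

(** After ad h the left side of [cp_yw1xz1] is 2 [x_2, y_1] + 2 [x_1, y_2], the right side 2
    [x_3, y] + 2 [x_2, y_1]. *)
Lemma cp_x3y : [br x3, y] = [br x1, y2].
Proof.
have hx2 : [br h, x2] = x3.
  by rewrite (cp_h cp) brDl brNl (cp_ex2 cp) subr0.
have := congr1 (br h) cp_yw1xz1.
rewrite brMnr brDr (br_jacobi h [br y, w1]) (br_jacobi h y) (br_jacobi h x).
rewrite (br_jacobi h w1) (br_jacobi h x2) hx2 (cp_hx cp) (cp_hx cpC).
rewrite (cp_hw1 cp) (cp_hw1 cpC) !(br0l, br0r, addr0).
rewrite br_brl (cp_w1xz1 cp) (cp_x1yw1 cpC) br0r subr0 (br_jacobi _ x1).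
rewrite (brC _ x1) (cp_x1yw1 cp) oppr0 br0l add0r (brC _ z1) (cp_w1xz1 cpC).
rewrite opprK brNr !brMnr (brC y1) mulNrn opprK mulrnDl addrC => /addIr.
by move/mulrn_injl->.
Qed.

(** On x, y and their shifts h acts as d, so the claim reads [x_2, y_1] = [x, y_3]. *)
Lemma cp_second_relation :
  [br [br h, x1], y1] - [br x, [br h, [br h, y1]]] = 0.
Proof.
have hy2 : [br h, y2] = y3.
  by rewrite (cp_h cp) brDl brNl (cp_ex2 cpC) subr0.
rewrite (cp_hx1 cp) (cp_hx1 cpC) hy2; apply/eqP; rewrite subr_eq0; apply/eqP.
have := congr1 (br d) (cp_xy2 cp).
by rewrite (br_jacobi d x) (br_jacobi d x2) -/x3 cp_x3y => /addrI.
Qed.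
End SecondRelation.
End LieAlgebra.

(** * Cartan matrix entries *)

Lemma cartanA_diag m (a : 'I_m) : cartanA a a = 2.
Proof. by rewrite /cartanA eqxx. Qed.

Lemma cartanA_adj m (a b : 'I_m) :
  (a.+1 == b :> nat) || (b.+1 == a :> nat) -> cartanA a b = -1.
Proof. by rewrite /cartanA -val_eqE /= => ab; rewrite ab ifF //; lia. Qed.

Lemma cartanA_far m (a b : 'I_m) :
  (a.+1 < b)%N || (b.+1 < a)%N -> cartanA a b = 0.
Proof. by rewrite /cartanA -val_eqE /= => ab; rewrite !ifF //; lia. Qed.

(** * The defining relations read in the quotient *)

Section Relations.
Variables (R : realType) (n : nat).
Local Notation c := (@cartanA (2 * n)).
Local Notation tau := (@tau n).
Local Notation b := (@Ub R n).
Local Notation h := (@Uh R n).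
Local Notation pi := (rel_pi (@U_rel_proper R n)).
Implicit Types i j k : 'I_(2 * n).

Lemma tauK : involutive tau.
Proof. exact: rev_ordK. Qed.

Lemma pi_rel x y : U_rel x y -> pi x = pi y.
Proof. by move=> xy; apply/rel_piP/RelIdealBase. Qed.

Lemma pi_lie x y : pi [lie x, y] = [lie pi x, pi y].
Proof. exact: rmorph_lie. Qed.

Lemma pi_scale a x : pi (a *: x) = a *: pi x.
Proof. exact: rel_piZ. Qed.

Lemma pi_sub x y : pi (x - y) = pi x - pi y.
Proof. exact: rmorphB. Qed.

Lemma Uhh i j r s : [lie h i r, h j s] = 0.
Proof. by rewrite -pi_lie (pi_rel (U_hh _ _ _ _ _)) rmorph0. Qed.

Lemma Uh1tau i : h (tau i) 1 = h i 1.
Proof.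
rewrite [RHS](pi_rel (U_htau _ _ _)) pi_scale.
by rewrite sqrrN expr1n scale1r.
Qed.

Lemma Uh0b i j r :
  [lie h i 0, b j r] = (c i j - c (tau i) j)%:~R *: b j r.
Proof. by rewrite -pi_lie (pi_rel (U_h0b _ _ _ _)) pi_scale. Qed.

Lemma Uh1b i j :
  [lie h i 1, b j 0] = (c i j + c (tau i) j)%:~R *: b j 1.
Proof. by rewrite -pi_lie (pi_rel (U_h1b _ _ _)) pi_scale. Qed.

Lemma Ub1b i j :
  [lie b i 1, b j 0] = [lie b i 0, b j 1] - (2 * (tau i == j))%:R *: h j 1.
Proof.
by rewrite -pi_lie (pi_rel (U_b1b _ _ _)) pi_sub pi_lie pi_scale.
Qed.

Lemma Ub1b_neq i j : (tau i == j) = false ->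
  [lie b i 1, b j 0] = [lie b i 0, b j 1].
Proof. by move=> ij; rewrite Ub1b ij muln0 scale0r; exact: subr0. Qed.

Lemma Ubbtau i (s : 'I_2) : c i (tau i) = 0 ->
  [lie b i 0, b (tau i) s] = h (tau i) s.
Proof.
move=> ci; rewrite -pi_lie (pi_rel (@U_bbtau R n i 0 s s erefl ci)).
by rewrite pi_scale expr0 scale1r.
Qed.

Lemma Ubb i j : c i j = 0 -> tau i != j -> [lie b i 0, b j 0] = 0.
Proof.
move=> cij /negPf ij.
by rewrite -pi_lie (pi_rel (U_bb _ cij)) ij scale0r rmorph0.
Qed.

Lemma Userre_tau i : c i (tau i) = -1 ->
  [lie b i 0, [lie b i 0, b (tau i) 0]] = b i 0 *+ 4.
Proof.
move=> ci; rewrite -!pi_lie (pi_rel (U_serre_tau _ ci)).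
by rewrite pi_scale scaler_nat.
Qed.

Lemma Userre i j : c i j = -1 -> i != tau i -> tau i != j ->
  [lie b i 0, [lie b i 0, b j 0]] = 0.
Proof.
by move=> cij ii ij; rewrite -!pi_lie (pi_rel (U_serre _ cij ii ij)) rmorph0.
Qed.

(** * The generators of the two innermost pairs form a [central_pair] *)

Section CentralPair.
Hypothesis hn : (2 <= n)%N.
Variable j : 'I_(2 * n).
Hypothesis hj : j.+1 = n.

Let i : 'I_(2 * n) := Ordinal (leq_ltn_trans (leq_pred j) (ltn_ord j)).
(** On the pairs of j and i, [h j 1] acts with coefficients (1, -1) and [h i 1] with (-1, 2).
    Inverting this matrix gives [d] with (1, 0) and [e] with (0, 1). *)
Let d : U R n := h j 1 *+ 2 + h i 1.
Let e : U R n := h j 1 + h i 1.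

Let nat_i : i = j.-1 :> nat. Proof. by []. Qed.
Let nat_tj : tau j = j.+1 :> nat. Proof. by rewrite /=; lia. Qed.
Let nat_ti : tau i = j.+2 :> nat. Proof. by rewrite /=; lia. Qed.

Let cjj : c j j = 2. Proof. exact: cartanA_diag. Qed.
Let cii : c i i = 2. Proof. exact: cartanA_diag. Qed.
Let ctjtj : c (tau j) (tau j) = 2. Proof. exact: cartanA_diag. Qed.
Let ctiti : c (tau i) (tau i) = 2. Proof. exact: cartanA_diag. Qed.
Let cij : c i j = -1. Proof. by rewrite cartanA_adj // nat_i; lia. Qed.
Let cji : c j i = -1. Proof. by rewrite cartanA_adj // nat_i; lia. Qed.
Let cjtj : c j (tau j) = -1. Proof. by rewrite cartanA_adj // nat_tj; lia. Qed.
Let ctjj : c (tau j) j = -1. Proof. by rewrite cartanA_adj // nat_tj; lia. Qed.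
Let ctitj : c (tau i) (tau j) = -1.
Proof. by rewrite cartanA_adj // nat_tj nat_ti; lia. Qed.
Let ctjti : c (tau j) (tau i) = -1.
Proof. by rewrite cartanA_adj // nat_tj nat_ti; lia. Qed.
Let citj : c i (tau j) = 0.
Proof. by rewrite cartanA_far // nat_tj nat_i; lia. Qed.
Let ctji : c (tau j) i = 0.
Proof. by rewrite cartanA_far // nat_tj nat_i; lia. Qed.
Let cjti : c j (tau i) = 0.
Proof. by rewrite cartanA_far // nat_ti; lia. Qed.
Let ctij : c (tau i) j = 0.
Proof. by rewrite cartanA_far // nat_ti; lia. Qed.
Let citi : c i (tau i) = 0.
Proof. by rewrite cartanA_far // nat_ti nat_i; lia. Qed.
Let ctii : c (tau i) i = 0.
Proof. by rewrite cartanA_far // nat_ti nat_i; lia. Qed.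
Let cE := (cjj, cii, ctjtj, ctiti, cij, cji, cjtj, ctjj, ctitj, ctjti,
  citj, ctji, cjti, ctij, citi, ctii).

Let ord_neF m (k l : 'I_m) : (k != l :> nat) -> (k == l) = false.
Proof. exact: negbTE. Qed.

Let tjj : (tau j == j) = false.
Proof. by apply: ord_neF; rewrite nat_tj; lia. Qed.
Let jtj : (j == tau j) = false. Proof. by rewrite eq_sym tjj. Qed.
Let tij : (tau i == j) = false.
Proof. by apply: ord_neF; rewrite nat_ti; lia. Qed.
Let jti : (j == tau i) = false. Proof. by rewrite eq_sym tij. Qed.
Let itj : (i == tau j) = false.
Proof. by apply: ord_neF; rewrite nat_tj nat_i; lia. Qed.
Let tji : (tau j == i) = false. Proof. by rewrite eq_sym itj. Qed.
Let ji : (j == i) = false.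
Proof. by apply: ord_neF; rewrite nat_i; lia. Qed.
Let tjti : (tau j == tau i) = false.
Proof. by apply: ord_neF; rewrite nat_tj nat_ti; lia. Qed.

Let act_d k : [lie d, b k 0] =
  ((c j k + c (tau j) k) *+ 2 + (c i k + c (tau i) k))%:~R *: b k 1.
Proof.
rewrite (brDl (@lieC _) (@lieDr _)) (brMnl (@lieC _) (@lieDr _)) !Uh1b.
by rewrite !scaler_int !mulr2n !mulrzDr.
Qed.

Let act_e k : [lie e, b k 0] =
  (c j k + c (tau j) k + (c i k + c (tau i) k))%:~R *: b k 1.
Proof. by rewrite (brDl (@lieC _) (@lieDr _)) !Uh1b -scalerDl -intrD. Qed.

Lemma U_dx : [lie d, b j 0] = b j 1.
Proof. by rewrite act_d !cE scale1r. Qed.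
Lemma U_dy : [lie d, b (tau j) 0] = b (tau j) 1.
Proof. by rewrite act_d !cE scale1r. Qed.
Let du : [lie d, b i 0] = 0.
Proof. by rewrite act_d !cE scale0r. Qed.
Let dv : [lie d, b (tau i) 0] = 0.
Proof. by rewrite act_d !cE scale0r. Qed.
Let ex : [lie e, b j 0] = 0.
Proof. by rewrite act_e !cE scale0r. Qed.
Let ey : [lie e, b (tau j) 0] = 0.
Proof. by rewrite act_e !cE scale0r. Qed.
Let eu : [lie e, b i 0] = b i 1.
Proof. by rewrite act_e !cE scale1r. Qed.
Let ev : [lie e, b (tau i) 0] = b (tau i) 1.
Proof. by rewrite act_e !cE scale1r. Qed.

Let dh k r : [lie d, h k r] = 0.
Proof.
rewrite (brDl (@lieC _) (@lieDr _)) (brMnl (@lieC _) (@lieDr _)) !Uhh.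
by rewrite mul0rn addr0.
Qed.

Let eh k r : [lie e, h k r] = 0.
Proof. by rewrite (brDl (@lieC _) (@lieDr _)) !Uhh addr0. Qed.

(** Without the h-term, the degree-shift relation makes this bracket its own negative. *)
Let b10 k : (tau k == k) = false -> [lie b k 0, b k 1] = 0.
Proof. by move=> /Ub1b_neq; rewrite lieC => /esym/eq_opp0. Qed.

Let uv r : [lie b i 0, b (tau i) r] = h (tau i) r.
Proof. exact: Ubbtau citi. Qed.

Lemma U_central_pair : central_pair (@lie_bracket (U R n)) d e (h j 1)
  (b j 0) (b (tau j) 0) (b i 0) (b (tau i) 0).
Proof.
split.
- by rewrite /d /e opprD addrA addrAC mulr2n addrK -addrA subrr addr0.
- by rewrite lieDr !dh addr0.
- exact: ex.
- exact: ey.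
- exact: du.
- exact: dv.
- by rewrite U_dx; exact: b10.
- by rewrite U_dy; apply: b10; rewrite tauK.
- by rewrite U_dx U_dy Ub1b eqxx muln1 scaler_nat Uh1tau subrK.
- by rewrite eu U_dx Ub1b_neq.
- by rewrite ev U_dy Ub1b_neq ?tauK.
- by rewrite Ubb ?tjti ?cE.
- by rewrite Ubb ?tauK ?ji ?cE.
- by rewrite Userre_tau ?cE.
(* Writing j as [tau (tau j)] exposes the Serre relation at [tau j]. *)
- by rewrite -{3}[j]tauK Userre_tau ?tauK ?cE.
- by rewrite Userre ?jtj ?tji ?cE.
- by rewrite Userre ?tauK ?tjj ?jti ?cE.
- by rewrite uv Uh0b tauK !cE sub0r opprK scale1r.
- by rewrite uv Uh0b tauK !cE subr0 mulrN1z scaleN1r.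
(* The brackets [u, v] and [u, v_1] are h-generators, so [d] and [e] commute with them. *)
- by rewrite uv; exact: dh.
- by rewrite uv; exact: eh.
- by rewrite ev uv; exact: eh.
Qed.
End CentralPair.
End Relations.

(* The hypothesis on j says that its 1-based label is n. *)
Theorem lemmaA2 (R : realType) (n : nat) (hn : (2 <= n)%N)
    (j : 'I_(2 * n)) (hj : j.+1 = n) :
  [/\ [lie Ub R j 1, [lie Ub R j 1, Ub R (tau j) 0]]
        + [lie Ub R (tau j) 1, [lie Ub R (tau j) 1, Ub R j 0]] = 0,
      [lie [lie Uh R j 1, Ub R j 1], Ub R (tau j) 1]
        - [lie Ub R j 0, [lie Uh R j 1, [lie Uh R j 1, Ub R (tau j) 1]]] = 0,
      [lie Ub R j 1, [lie Ub R j 1, Ub R (tau j) 0]] = 0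
    & [lie Ub R (tau j) 1, [lie Ub R (tau j) 1, Ub R j 0]] = 0].
Proof.
have cp := U_central_pair R hn hj.
have cpC := central_pairC (@lieC _) (@lieDr _) (@lie_jacobi _) cp.
have dx := U_dx R hn hj; have dy := U_dy R hn hj.
have := cp_second_relation (@lieC _) (@lieDr _) (@lie_jacobi _) cp.
have := cp_x1x1y (@lieC _) (@lieDr _) (@lie_jacobi _) cp.
have := cp_x1x1y (@lieC _) (@lieDr _) (@lie_jacobi _) cpC.
rewrite dx dy => yyx xxy second.
split; [by rewrite xxy yyx; exact: addr0 | exact: second | exact: xxy |].
exact: yyx.
Qed.
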